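(* For every $n\ge1$, $$\sum_{K\in Sp_{2n}(\mathbb{Z}_2)}(-1)^{o(K)}=-2^{n^2}\,[2]_2[4]_2\cdots[2n-2]_2,$$ where $o(K)$ is the number of entries equal to $1$ in $K$.
   Context: Let $J$ be the $n\times n$ matrix with $1$'s on the antidiagonal and $0$ elsewhere, and $M=\begin{pmatrix}0&J\\-J&0\end{pmatrix}$. Then $Sp_{2n}(\mathbb{F})=\{A\in SL_{2n}(\mathbb{F}): A^TMA=M\}$; here $\mathbb{F}=\mathbb{Z}_2$ is the field with two elements. For $m\ge1$, $[m]_2=1+2+\cdots+2^{m-1}=2^m-1$; an empty product equals $1$. *)

(* Defs.v *)
From HB Require Import structures.
From mathcomp Require Import all_boot all_order all_algebra.

Set Implicit Arguments.
Unset Strict Implicit.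
Unset Printing Implicit Defensive.

Import GRing.Theory.
Local Open Scope ring_scope.

Definition antidiag_mx (F : fieldType) (n : nat) : 'M[F]_n :=
  \matrix_(i, j) (j == rev_ord i)%:R.

Definition symp_form (F : fieldType) (n : nat) : 'M[F]_(n + n) :=
  block_mx 0 (antidiag_mx F n) (- antidiag_mx F n) 0.

Definition Sp (F : finFieldType) (n : nat) : {set 'M[F]_(n + n)} :=
  [set A | (\det A == 1) && (A^T *m symp_form F n *m A == symp_form F n)].

Definition num_ones (F : finFieldType) (m : nat) (K : 'M[F]_m) : nat :=
  #|[set ij : 'I_m * 'I_m | K ij.1 ij.2 == 1]|.

Definition qint (q : int) (m : nat) : int := \sum_(i < m) q ^+ i.

(* Main.v *)
(* The sign (-1)^o(K) is chi(1^T K 1), for chi the nontrivial additive character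
   of F_2 and 1 the all-ones vector.  Build the rows of a symplectic matrix one at
   a time: each new row ranges over a set whose size does not depend on the rows
   already chosen, so the first chosen row is equidistributed on the nonzero
   vectors, and any nonzero vector can be that row.  Translating by a symplectic Q
   whose first chosen row is 1^T turns 1^T A into the first chosen row of A, and
   chi(v 1) sums to -1 over the nonzero v. *)
Require Import Defs.
From HB Require Import structures.
From mathcomp Require Import all_boot all_order all_algebra mxabelem zify.

Set Implicit Arguments.
Unset Strict Implicit.
Unset Printing Implicit Defensive.

Import Num.Theory GRing.Theory.
Local Open Scope ring_scope.

(** * Linear algebra for matrices built row by row *)

Lemma row_free_col_mx (F : fieldType) (k m : nat) (x : 'rV[F]_m) (A : 'M_(k, m)) :
  row_free (col_mx x A) = row_free A && ~~ (x <= A)%MS.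
Proof.
apply/idP/andP => [freeC | [freeA xNA]].
  have inj u (v : 'rV_k) : u *m x + v *m A = 0 -> u = 0 :> 'M_1 /\ v = 0.
    rewrite -mul_row_col -(mul0mx 1 (col_mx x A)) => /(row_free_inj freeC).
    by rewrite -[0]row_mx0 => /eq_row_mx.
  split.
    by apply: inj_row_free => v vA; case: (inj 0 v); rewrite // mul0mx add0r.
  apply/negP => /submxP[v xE].
  case: (inj 1%:M (- v)); first by rewrite mul1mx mulNmx -xE subrr.
  by move/eqP; rewrite -mxrank_eq0 mxrank1.
apply: inj_row_free => w; rewrite -[w]hsubmxK mul_row_col.
set u := lsubmx w; set v := rsubmx w; rewrite [u]mx11_scalar mul_scalar_mx.
have [-> | u_neq0 /eqP] := eqVneq (u 0 0) 0.
  rewrite scale0r add0r => /eqP; rewrite mulmx_free_eq0 // => /eqP->.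
  by rewrite raddf0 row_mx0.
rewrite addr_eq0 => /eqP uxE; case/negP: xNA.
rewrite -[x](scalerK u_neq0) uxE scalemx_sub // -mulNmx; exact: submxMl.
Qed.

(** The fibre is a translate of the left kernel of [B], which has dimension [m - k]. *)
Lemma card_mulmx_fiber (F : finFieldType) (m k : nat) (B : 'M[F]_(m, k)) (b : 'rV_k) :
  row_full B -> #|[set x : 'rV_m | x *m B == b]| = (#|F| ^ (m - k))%N.
Proof.
move=> fullB; have /submxP[x0 x0B] := submx_full b fullB.
have -> : [set x | x *m B == b] = [set x + x0 | x in rowg (kermx B)].
  apply/setP => x; rewrite inE; apply/eqP/imsetP => [xB | [y]].
    exists (x - x0); last by rewrite subrK.
    by rewrite inE; apply/sub_kermxP; rewrite mulmxBl xB x0B subrr.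
  by rewrite inE => /sub_kermxP yB ->; rewrite mulmxDl yB add0r.
rewrite card_imset; last exact: addIr.
by rewrite card_rowg mxrank_ker (eqP fullB).
Qed.

Lemma big_col_mx (R : Type) (idx : R) (op : Monoid.com_law idx) (T : finType)
    (k1 k2 m : nat) (P : pred 'M[T]_(k1 + k2, m)) (F : 'M_(k1 + k2, m) -> R) :
  \big[op/idx]_(B | P B) F B =
  \big[op/idx]_(A : 'M_(k2, m)) \big[op/idx]_(x : 'M_(k1, m) | P (col_mx x A))
    F (col_mx x A).
Proof.
rewrite pair_big_dep /= (reindex (fun p : 'M_(k2, m) * 'M_(k1, m) => col_mx p.2 p.1)) //.
exists (fun B => (dsubmx B, usubmx B)) => [[A x] | B] _ /=.
  by rewrite col_mxKd col_mxKu.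
exact: vsubmxK.
Qed.

Lemma oppr_F2 (V : lmodType 'F_2) (x : V) : - x = x.
Proof. by rewrite -scaleN1r oppr_pchar2 ?scale1r // pchar_Fp. Qed.

(** * Frames of the symplectic form over ['F_2] *)

Section Form.
Variable n : nat.
Local Notation m := (n + n)%N.
Local Notation M := (symp_form 'F_2 n).

(** In characteristic 2 the sign of the lower block disappears, so the form is the full antidiagonal
    matrix. *)
Lemma symp_form_F2E i j : M i j = (i + j + 1 == m)%N%:R.
Proof.
rewrite /symp_form oppr_F2 /antidiag_mx.
have J (i0 j0 : 'I_n) : (j0 == rev_ord i0) = (i0 + j0 + 1 == n)%N.
  by apply/eqP/eqP => [-> /= | e]; [|apply/val_inj => /=]; have := ltn_ord i0; lia.
case: (split_ordP i) => i0 ->; case: (split_ordP j) => j0 -> /=;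
  rewrite ?(block_mxEul, block_mxEur, block_mxEdl, block_mxEdr) !mxE ?J /=;
  move: (ltn_ord i0) (ltn_ord j0) => ? ?;
  try (by rewrite (_ : (_ == (_ + _)%N) = false) //; lia);
  congr (nat_of_bool _)%:R; lia.
Qed.

Lemma tr_symp_form : M^T = M.
Proof. by apply/matrixP => i j; rewrite mxE !symp_form_F2E (addnC i). Qed.

(** The two off-diagonal blocks contribute a 1x1 matrix and its transpose, which cancel in
    characteristic 2. *)
Lemma symp_form_alt (x : 'rV_m) : x *m M *m x^T = 0.
Proof.
rewrite -[x]hsubmxK; set a := lsubmx x; set b := rsubmx x.
rewrite mul_row_block tr_row_mx mul_row_col !mulmx0 add0r addr0.
rewrite oppr_F2 [X in X + _]mx11_scalar [X in _ + X]mx11_scalar -raddfD /=.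
have trJ : (antidiag_mx 'F_2 n)^T = antidiag_mx 'F_2 n.
  by apply/matrixP => i j; rewrite !mxE -(can_eq (@rev_ordK n)) rev_ordK eq_sym.
have -> : b *m antidiag_mx 'F_2 n *m a^T = (a *m antidiag_mx 'F_2 n *m b^T)^T.
  by rewrite !trmx_mul trmxK trJ mulmxA.
by rewrite mxE addrr_pchar2 ?pchar_Fp // raddf0.
Qed.

Lemma symp_form_unit : M \in unitmx.
Proof.
have MM : M *m M = 1%:M.
  apply/matrixP => i j; rewrite mxE (bigD1 (rev_ord i)) //= big1 => [|l lNi].
    rewrite addr0 !symp_form_F2E mxE -natrM mulnb; congr (nat_of_bool _)%:R.
    by rewrite -val_eqE /=; have := ltn_ord i; have := ltn_ord j; lia.
  rewrite !symp_form_F2E; case: eqP => [e|]; last by rewrite mul0r.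
  by case/eqP: lNi; apply/val_inj => /=; lia.
by case: (mulmx1_unit MM).
Qed.

(* Rows are added on top: row i of a k-row matrix is the (k-1-i)-th vector chosen,
   and the a-th and b-th vectors chosen pair to 1 exactly when a + b = 2n - 1.
   Hence the last row is the first vector chosen. *)
Definition gram k : 'M['F_2]_k := \matrix_(i, j) (i + j + m.+1 == k.*2)%N%:R.

Definition frames k : {set 'M['F_2]_(k, m)} :=
  [set A | row_free A && (A *m M *m A^T == gram k)].

(** Column [j] of the prescribed row is column [j + 1] of the top row of [gram k.+1]. *)
Definition extends k (A : 'M['F_2]_(k, m)) (x : 'rV_m) :=
  ~~ (x <= A)%MS && (x *m (M *m A^T) == \row_j (j + m == k.*2)%N%:R).

(** Adding [x] borders the Gram matrix: the corner is 0 because the form is alternating, and the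
    left border is the transpose of the top one, so only the pairings of [x] with the rows of [A]
    remain to be prescribed. *)
Lemma col_mx_frames k (x : 'rV_m) (A : 'M_(k, m)) :
  (col_mx x A \in frames k.+1) = (A \in frames k) && extends A x.
Proof.
rewrite !inE row_free_col_mx /extends -!andbA; congr (_ && _).
rewrite [RHS]andbCA; congr (_ && _).
have -> : gram k.+1 =
    block_mx 0 (\row_j (j + m == k.*2)%N%:R) (\row_j (j + m == k.*2)%N%:R)^T (gram k)
    :> 'M_(1 + k).
  apply/matrixP => i j.
  case: (split_ordP i) => i0 ->; case: (split_ordP j) => j0 -> /=;
  rewrite ?(block_mxEul, block_mxEur, block_mxEdl, block_mxEdr) !mxE /= ?ord1 /=.
  - by rewrite (_ : (_ == _) = false) //; lia.
  - by congr (nat_of_bool _)%:R; lia.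
  - by congr (nat_of_bool _)%:R; lia.
  - by congr (nat_of_bool _)%:R; lia.
rewrite (mul_col_mx x A) (tr_col_mx x A) (mul_col_row (x *m M) (A *m M) x^T A^T).
rewrite symp_form_alt.
have -> : A *m M *m x^T = (x *m (M *m A^T))^T.
  by rewrite !trmx_mul trmxK tr_symp_form.
rewrite -mulmxA; apply/eqP/andP => [e | [/eqP-> /eqP->] //].
by case: (@eq_block_mx _ 1 k 1 k _ _ _ _ _ _ _ _ e) => _ -> _ ->.
Qed.

Lemma frames_gram k (A : 'M_(k, m)) : A \in frames k -> A *m M *m A^T = gram k.
Proof. by rewrite inE => /andP[_ /eqP]. Qed.

(* For k < n the k vectors chosen are isotropic, so their span lies in their
   orthogonal and has to be removed; for k >= n the new vector must pair to 1 with
   one of them, and is then automatically independent. *)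
Definition ext_count k : int := 2 ^+ (m - k) - (if (k < n)%N then 2 ^+ k else 0).

(** The pairing condition is a linear system of full rank with [2 ^ (m - k)] solutions; it remains
    to compare these with the span of [A]. *)
Lemma card_extends k (A : 'M_(k, m)) : (k < m)%N -> A \in frames k ->
  #|[set x | extends A x]|%:Z = ext_count k.
Proof.
move=> k_lt_m frA; have := frA; rewrite inE => /andP[freeA _].
pose b : 'rV['F_2]_k := \row_j (j + m == k.*2)%N%:R.
have fullMA : row_full (M *m A^T).
  rewrite /row_full -mxrank_tr trmx_mul trmxK tr_symp_form mxrankMfree //.
  by rewrite row_free_unit symp_form_unit.
have cardb := card_mulmx_fiber b fullMA; rewrite card_Fp // in cardb.
have spanA v : v *m A *m (M *m A^T) = v *m gram k.
  by rewrite -(frames_gram frA) !mulmxA.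
rewrite /ext_count; case: ltnP => [k_lt_n | n_le_k].
  have gram0 : gram k = 0.
    by apply/matrixP => i j; rewrite !mxE (_ : (_ == _) = false) //; lia.
  have b0 : b = 0.
    apply/rowP => j; rewrite !mxE (_ : (_ == _) = false) //.
    by have := ltn_ord j; lia.
  have -> : [set x | extends A x] = [set x | x *m (M *m A^T) == b] :\: rowg A.
    by apply/setP => x; rewrite !inE.
  rewrite cardsD (setIidPr _) ?card_rowg ?cardb ?card_Fp ?(eqP freeA) //.
    rewrite -subzn ?leq_exp2l //; last by lia.
    by rewrite -!natz !natrX.
  apply/subsetP => x; rewrite !inE => /submxP[v ->].
  by rewrite spanA gram0 mulmx0 b0.
have -> : [set x | extends A x] = [set x | x *m (M *m A^T) == b].
  apply/setP => x; rewrite !inE /extends andb_idl // => /eqP xb.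
  apply/negP => /submxP[v xE].
  (* This column belongs to the partner of the new vector: the prescribed pairing is 1 there, while
     the same column of [gram k] is zero, so no vector in the span of [A] qualifies. *)
  have j_lt_k : (k.*2 - m < k)%N by lia.
  have := congr1 (fun u : 'rV_k => u 0 (Ordinal j_lt_k)) xb.
  rewrite xE spanA !mxE big1 => [|i _].
    by rewrite /= (_ : (_ == _) = true) //; lia.
  by rewrite mxE /= (_ : (_ == _) = false) ?mulr0 //; lia.
by rewrite cardb subr0 -natz natrX.
Qed.

(** Induction on [k]: a new top row keeps the last row and can be chosen in equally many ways for
    every frame. The product starts at 1 because choice 0 is [v] itself. *)
Lemma sum_frames (f : 'rV['F_2]_m -> int) k : (k < m)%N ->
  \sum_(A in frames k.+1) f (row ord_max A) =
  (\prod_(1 <= j < k.+1) ext_count j) * \sum_(v | v != 0) f v.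
Proof.
elim: k => [|k IHk] k_lt_m.
  rewrite big_geq // mul1r; apply: eq_big => [A | A _].
    (* A single row is a frame exactly when it is nonzero, since the form is alternating. *)
    rewrite inE [X in X == gram 1]symp_form_alt /row_free rank_rV eqb1 andb_idr //.
    move=> _; apply/eqP/rowP => j.
    by rewrite !ord1 !mxE /= (_ : (_ == _) = false) //; lia.
  by congr (f _); apply/rowP => j; rewrite mxE; congr (A _ j); apply: val_inj.
rewrite big_nat_recr //= mulrAC -IHk; last by lia.
rewrite (@big_col_mx _ _ _ _ 1 k.+1) mulr_suml [RHS]big_mkcond /=.
apply: eq_bigr => A _; under eq_bigl => x do rewrite col_mx_frames.
have [frA | _] := ifPn; last by rewrite big_pred0.
have rowA x : row (ord_max : 'I_(1 + k.+1)) (col_mx x A) = row ord_max A.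
  have -> : ord_max = rshift 1 ord_max :> 'I_(1 + k.+1) by exact: val_inj.
  by apply/rowP => j; rewrite [LHS]mxE [RHS]mxE col_mxEd.
under eq_bigr => x _ do rewrite rowA.
rewrite sumr_const -(card_extends k_lt_m frA) -mulr_natr natz.
by congr (_ * Posz _); apply: eq_card => x; rewrite [RHS]inE.
Qed.

Lemma gram_full : gram m = M.
Proof.
by apply/matrixP => i j; rewrite symp_form_F2E mxE; congr (nat_of_bool _)%:R; lia.
Qed.

(** Preserving the form forces [K] to be invertible; over ['F_2] this gives both determinant 1 and
    free rows. *)
Lemma Sp_F2E (K : 'M_m) : (K \in Sp 'F_2 n) = (K^T \in frames m).
Proof.
rewrite !inE trmxK gram_full; have [KMK | _] := eqVneq (K^T *m M *m K) M;
  last by rewrite !andbF.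
have : K^T *m M *m K \in unitmx by rewrite KMK symp_form_unit.
rewrite !unitmx_mul unitmx_tr row_free_unit => /andP[_ unitK].
rewrite !andbT unitmx_tr unitK; move: unitK; rewrite unitmxE unitfE.
by case: (\det K) => [[|[|]]].
Qed.

Lemma mulmx_frames (P Q : 'M_m) :
  P \in frames m -> (P *m Q \in frames m) = (Q \in frames m).
Proof.
rewrite !inE gram_full !row_free_unit unitmx_mul => /andP[unitP /eqP PMP].
have -> : P *m Q *m M *m (P *m Q)^T = P *m (Q *m M *m Q^T) *m P^T.
  by rewrite trmx_mul !mulmxA.
rewrite unitP -[X in _ == X]PMP.
by rewrite (can_eq (mulmxK _)) ?unitmx_tr // (can_eq (mulKmx unitP)) //.
Qed.

(** The factor is [2 ^ j * (2 ^ (2 * (n - j)) - 1)] for [j < n] and [2 ^ (2 * n - j)] for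
    [n <= j]. *)
Lemma prod_ext_count : (0 < n)%N ->
  \prod_(1 <= j < m) ext_count j = 2 ^+ (n ^ 2) * \prod_(1 <= k < n) qint 2 (2 * k).
Proof.
move=> n_gt0.
have qintE k : qint 2 k = 2 ^+ k - 1.
  by rewrite subrX1 /qint; rewrite (_ : 2 - 1 = 1) // mul1r.
rewrite (@big_cat_nat _ _ _ n) //=; last exact: leq_addr.
have -> : \prod_(1 <= j < n) ext_count j =
    \prod_(1 <= j < n) 2 ^+ j * \prod_(1 <= k < n) qint 2 (2 * k).
  rewrite [X in _ * X]big_nat_rev -big_split /=.
  apply: eq_big_nat => j /andP[j_gt0 j_lt_n].
  rewrite /ext_count j_lt_n qintE mulrBr mulr1 -exprD; congr (_ ^+ _ - _); lia.
have -> : \prod_(n <= j < m) ext_count j = \prod_(0 <= j < n) 2 ^+ (n - j).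
  rewrite -{1}[n]add0n big_addn addnK; apply: eq_big_nat => j _.
  by rewrite /ext_count ltnNge leq_addl /= subr0; congr (_ ^+ _); lia.
rewrite mulrAC; congr (_ * _).
(* With the trivial factor [j = 0] both products have [n] factors, which pair up as
   [2 ^ j * 2 ^ (n - j) = 2 ^ n]. *)
have -> : \prod_(1 <= j < n) (2 : int) ^+ j = \prod_(0 <= j < n) 2 ^+ j.
  by rewrite [RHS]big_ltn // expr0 mul1r.
rewrite -big_split /= (eq_big_nat _ _ (F2 := fun=> 2 ^+ n)) => [|j /andP[_ j_lt_n]].
  by rewrite prodr_const_nat subn0 -exprM -mulnn.
by rewrite -exprD subnKC // ltnW.
Qed.

End Form.

(** * The additive character and the signed sum *)

Definition chi2 (x : 'F_2) : int := (-1) ^+ (x == 1).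

Lemma chi2D x y : chi2 (x + y) = chi2 x * chi2 y.
Proof. by case: x y => [[|[|]]] // ? [[|[|]]]. Qed.

Lemma chi2_sum (I : finType) (F : I -> 'F_2) :
  chi2 (\sum_i F i) = \prod_i chi2 (F i).
Proof. exact: (big_morph chi2 chi2D). Qed.

(** Translation by a basis vector on which [u] is 1 flips every sign, so the sum over all [v]
    vanishes; [v = 0] contributes 1 to it. *)
Lemma sum_chi2_neq0 k (u : 'cV['F_2]_k) : u != 0 ->
  \sum_(v : 'rV_k | v != 0) chi2 ((v *m u) 0 0) = -1.
Proof.
move=> u_neq0; have [i ui] : exists i, u i 0 = 1.
  have /cV0Pn[i ui] := u_neq0.
  by exists i; case: (u i 0) ui => [[|[|]]] //= ? _; apply: val_inj.
suff : \sum_(v : 'rV_k) chi2 ((v *m u) 0 0) = 0.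
  rewrite (bigD1 0) //= mul0mx mxE => /eqP; rewrite addrC addr_eq0 => /eqP->.
  by [].
set s := (X in X = 0).
have : s = - s.
  rewrite {1}/s (reindex_inj (addrI (delta_mx 0 i))) /= -sumrN.
  apply: eq_bigr => v _; rewrite mulmxDl mxE chi2D -rowE mxE ui.
  by rewrite /chi2 eqxx mulN1r.
lia.
Qed.

(** The matrix product adds up all entries of [K], and [chi2] turns that sum into a product with one
    sign -1 per entry equal to 1. *)
Lemma chi2_num_ones k (K : 'M['F_2]_k) :
  (-1) ^+ num_ones K = chi2 ((const_mx 1 *m K^T *m const_mx 1 : 'M_1) 0 0).
Proof.
rewrite /num_ones -sum1_card big_mkcond /= [RHS](_ : _ = chi2 (\sum_p K p.1 p.2)).
  rewrite chi2_sum -prodrXr; apply: eq_bigr => p _.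
  by rewrite inE /chi2; case: (_ == _).
congr chi2; rewrite -(pair_bigA _ (fun i j => K i j)) mxE.
by apply: eq_bigr => i _; rewrite !mxE mulr1; apply: eq_bigr => j _; rewrite !mxE mul1r.
Qed.

Theorem theorem4p1 (n : nat) (hn : (1 <= n)%N) :
  \sum_(K in Sp 'F_2 n) (-1) ^+ num_ones K =
  - (2 ^+ (n ^ 2) * \prod_(1 <= k < n) qint 2 (2 * k)) :> int.
Proof.
case: n hn => // n _; set N := n.+1.
set m := (N + N)%N.
have prod_gt0 : 0 < \prod_(1 <= j < m) ext_count N j.
  rewrite big_nat; apply: prodr_gt0 => j /andP[_ j_lt_m].
  rewrite /ext_count; case: ifP => j_lt_N; last by rewrite subr0 exprn_gt0.
  by rewrite subr_gt0 ltr_eXn2l //; lia.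
pose u : 'rV['F_2]_m := const_mx 1.
have u_neq0 : u != 0 by apply/eqP => /rowP/(_ ord0); rewrite !mxE.
(* Applied to the indicator of [u], [sum_frames] counts the frames with last row [u]; the count is
   the product just shown to be positive. *)
have [Q frQ rowQ] : exists2 Q, Q \in frames N m & row ord_max Q = u.
  have := @sum_frames N (fun v => (v == u)%:R) m.-1 (leqnn _).
  rewrite [X in _ * X](bigD1 u) //= eqxx [X in 1 + X]big1 => [|v /andP[_ /negPf->]] //.
  rewrite addr0 mulr1.
  have [Q /= /andP[frQ /eqP rowQ] | none] :=
      pickP [pred Q : 'M_m | (Q \in frames N m) && (row ord_max Q == u)].
    by exists Q.
  rewrite big1 => [e | Q frQ]; first by move: prod_gt0; rewrite -e.
  by have := none Q; rewrite /= frQ /= => ->.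
have unitQ : Q \in unitmx by move: frQ; rewrite inE row_free_unit => /andP[].
(* Pass to transposes, whose rows form frames; [u *m A] is then the last row of [Q *m A]. *)
rewrite (reindex_inj (inv_inj (@trmxK _ _ _))) /=.
under eq_bigl => A do rewrite Sp_F2E trmxK.
under eq_bigr => A _ do rewrite chi2_num_ones trmxK -/u -rowQ -row_mul.
rewrite [LHS](_ : _ =
    \sum_(A in frames N m) chi2 ((row ord_max A *m (const_mx 1 : 'cV_m)) 0 0)).
  rewrite (@sum_frames N (fun v => chi2 ((v *m const_mx 1) 0 0)) m.-1 (leqnn _)).
  rewrite sum_chi2_neq0 ?mulrN1; first by rewrite -(prod_ext_count (ltn0Sn n)).
  by apply/eqP => /colP/(_ ord0); rewrite !mxE.
(* Left multiplication by [Q] permutes the full frames. *)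
rewrite [RHS](reindex_inj (can_inj (mulKmx unitQ))) /=.
by apply: eq_bigl => A; rewrite mulmx_frames.
Qed.
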